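(* Let $p$ be a prime, let $m\ge 2$, and let $k_1,\dots,k_m,\lambda_1,\dots,\lambda_m$ be positive integers with $k_1+\dots+k_m\le p$. Then there does not exist a $(p+1,m;k_1,\dots,k_m;\lambda_1,\dots,\lambda_m)$-GSEDF (in any abelian group of order $p+1$).
   Context: Let $G$ be a finite abelian group of order $v$, written additively with identity $0$, let $m\ge 2$, and let $\lambda_1,\dots,\lambda_m$ be positive integers. For disjoint subsets $A,B\subseteq G$, let $\Delta(A,B)$ be the multiset $\{x-y : x\in A, y\in B\}$. A $(v,m;k_1,\dots,k_m;\lambda_1,\dots,\lambda_m)$-generalized strong external difference family (GSEDF) in $G$ is a collection $\{D_1,\dots,D_m\}$ of mutually disjoint nonempty subsets of $G$ with $|D_i|=k_i$ such that for every $i$, $1\le i\le m$, the multiset union $\bigcup_{1\le j\le m,\, j\ne i}\Delta(D_i,D_j)$ contains every element of $G\setminus\{0\}$ exactly $\lambda_i$ times and does not contain $0$. *)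

(* Defs.v *)
From mathcomp Require Import all_boot all_order all_algebra.
From mathcomp Require Import finmap multiset.

Set Implicit Arguments.
Unset Strict Implicit.
Unset Printing Implicit Defensive.

Import GRing.Theory.
Local Open Scope ring_scope.
Local Open Scope mset_scope.

Definition Delta (G : finZmodType) (A B : {set G}) : {mset G} :=
  seq_mset [seq x - y | x <- enum A, y <- enum B].

(* The union in the definition of a GSEDF adds multiplicities, hence [msetD]
   (multiset sum) and not [msetU] (pointwise maximum). *)
Definition out_diffs (G : finZmodType) (m : nat) (D : 'I_m -> {set G})
    (i : 'I_m) : {mset G} :=
  \big[msetD/mset0]_(j < m | j != i) Delta (D i) (D j).

Record is_GSEDF (G : finZmodType) (v m : nat) (k lam : 'I_m -> nat)
    (D : 'I_m -> {set G}) : Prop := IsGSEDF {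
  gsedf_order : #|G| = v;
  gsedf_disjoint : forall i j : 'I_m, i != j -> [disjoint D i & D j];
  gsedf_nonempty : forall i : 'I_m, D i != set0;
  gsedf_card : forall i : 'I_m, #|D i| = k i;
  gsedf_diff : forall (i : 'I_m) (g : G), g != 0 -> out_diffs D i g = lam i;
  gsedf_diff0 : forall i : 'I_m, (0 : G) \notin out_diffs D i
}.

(* Main.v *)
Require Import Defs.
From mathcomp Require Import all_boot all_order all_algebra.
From mathcomp Require Import finmap multiset.

(** Fix one block, of size a, and let b be the total size of the others. Counting the differences
    from that block to the others in two ways ([GSEDF_count]) gives a * b = lam * p, since a group
    of order p + 1 has p nonzero elements. So the prime p divides a or b. But a and b are positive
    with a + b <= p, so both lie strictly between 0 and p, a contradiction. *)

Lemma sum_count_mem (T : finType) (s : seq T) :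
  \sum_(x : T) count_mem x s = size s.
Proof.
elim: s => [|y s IHs] /=; first by rewrite big1.
rewrite big_split /= IHs (bigD1 y) //= eqxx big1 ?addn0 // => x /negPf.
by rewrite eq_sym => ->.
Qed.

Lemma sum_Delta (G : finZmodType) (A B : {set G}) :
  \sum_(g : G) Delta A B g = #|A| * #|B|.
Proof.
under eq_bigr => g _ do rewrite /Delta mset_seqE.
by rewrite sum_count_mem size_allpairs -!cardE.
Qed.

Lemma out_diffsE (G : finZmodType) (m : nat) (D : 'I_m -> {set G})
    (i : 'I_m) (g : G) :
  out_diffs D i g = \sum_(j < m | j != i) Delta (D i) (D j) g.
Proof.
rewrite /out_diffs; apply: (big_morph (fun A : {mset G}%mset => A g)) => [A B|].
  by rewrite msetE2.
by rewrite mset0E.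
Qed.

(** Both sides are the size of the multiset [out_diffs D i]: on the left summed block by block, on
    the right element by element, where 0 contributes nothing. *)
Lemma GSEDF_count (G : finZmodType) (v m : nat) (k lam : 'I_m -> nat)
    (D : 'I_m -> {set G}) (i : 'I_m) :
  is_GSEDF v k lam D ->
  k i * \sum_(j < m | j != i) k j = lam i * v.-1.
Proof.
case=> vG _ _ kD lamD lamD0.
have <- : \sum_(g : G) out_diffs D i g = lam i * v.-1.
  rewrite (bigD1 0%R) //= (mset_eq0P (lamD0 i)) add0n.
  rewrite (eq_bigr (fun=> lam i)); last exact: lamD.
  by rewrite sum_nat_const cardC1 vG mulnC.
rewrite (eq_bigr _ (fun g _ => out_diffsE _ _ D i g)) exchange_big big_distrr /=.
by apply: eq_bigr => j _; rewrite sum_Delta !kD.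
Qed.

Theorem theorem3p1 (p m : nat) (k lam : 'I_m -> nat) :
  prime p -> (2 <= m)%N ->
  (forall i : 'I_m, (0 < k i)%N) -> (forall i : 'I_m, (0 < lam i)%N) ->
  (\sum_(i < m) k i <= p)%N ->
  forall G : finZmodType,
    ~ exists D : 'I_m -> {set G}, is_GSEDF (p + 1)%N k lam D.
Proof.
case: m k lam => [|[|m]] // k lam p_pr _ k_gt0 _ sum_le G [D /GSEDF_count count].
have := count ord0; rewrite addn1 /= => k0E.
have : p %| k ord0 * \sum_(j < m.+2 | j != ord0) k j by rewrite k0E dvdn_mull.
move: sum_le; rewrite (bigD1 ord0) //=.
have : 0 < \sum_(j < m.+2 | j != ord0) k j.
  (* With at least two blocks, [ord_max] differs from [ord0], so its positive size already makes b
     positive. *)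
  by rewrite (bigD1 ord_max) //= ltn_addr.
move: (k_gt0 ord0) (\sum_(j < _ | _) _) => a_gt0 b b_gt0 sum_le.
(* It remains to bound each factor strictly below p: each is less than a + b because the other is
   positive. *)
rewrite Euclid_dvdM // !gtnNdvd //; apply: leq_trans sum_le.
  by rewrite -[X in X < _]add0n ltn_add2r.
by rewrite -[X in X < _]addn0 ltn_add2l.
Qed.
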